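(* Let $0<\eta<1$ and let $\boldsymbol{x}_0,\dots,\boldsymbol{x}_n$ be pairwise independent $\eta$-HC real random variables with $\sigma_j^2=\|\boldsymbol{x}_j\|_2^2$ and $\tau_i^2=\sum_{j\ge i}\sigma_j^2$. Let $0<\delta<1$, $0<\epsilon<1/2$, $s>1$, and let $L=br$ with $b=\lceil(2/\eta^4)\ln(1/\epsilon)\rceil$ and $r=\lceil(1/(\eta^4\delta))\ln(1+16s^2)\rceil$; note $L\le O\big(\frac{\log(s)\log(1/\epsilon)}{\eta^8}\big)\cdot\frac1\delta$. Assume the sequence is ordered ($\sigma_0^2\ge\sigma_1^2\ge\dots$), that $n\ge L$, and that $\boldsymbol{x}_0,\dots,\boldsymbol{x}_{L-1}$ are independent. If the $\delta$-critical index $\ell$ of the sequence satisfies $\ell\ge L$, then for all $\theta\in\mathbb{R}$, $$\Pr\big[|\boldsymbol{x}_0+\dots+\boldsymbol{x}_{L-1}-\theta|\le s\cdot\tau_L\big]\le\epsilon+\frac{O(\ln(1/\epsilon))}{\eta^8s^4}.$$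
   Context: $\|\boldsymbol{x}\|_p=\mathbb{E}[|\boldsymbol{x}|^p]^{1/p}$. A real random variable $\boldsymbol{x}$ is $\eta$-HC if $0<\|\boldsymbol{x}\|_4<\infty$ and $\|a+\eta\boldsymbol{x}\|_4\le\|a+\boldsymbol{x}\|_2$ for all $a\in\mathbb{R}$. A collection $\boldsymbol{x}_i,\dots,\boldsymbol{x}_n$ is $\delta$-regular if $\sum_{j}\|\boldsymbol{x}_j\|_4^4\le\delta(\sum_j\|\boldsymbol{x}_j\|_2^2)^2$ (sums over the collection). For an ordered sequence, the $\delta$-critical index is the smallest $\ell$ such that $\boldsymbol{x}_\ell,\dots,\boldsymbol{x}_n$ is $\delta$-regular, or $\infty$ if no such index exists.
   Formalization: The remark L ≤ O(log(s)log(1/ε)/η^8)·1/δ fails with an absolute constant as s→1 (log s→0 while L≥1); it is proved for all s ≥ s0 with a constant depending only on s0, for each s0>1. *)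

(* Defs.v *)
From HB Require Import structures.
From mathcomp Require Export all_boot all_order all_algebra.
From mathcomp Require Export all_classical all_reals all_analysis.

Set Implicit Arguments.
Unset Strict Implicit.
Unset Printing Implicit Defensive.

Import Order.TTheory GRing.Theory Num.Theory.
Import numFieldNormedType.Exports.

Local Open Scope classical_set_scope.
Local Open Scope ring_scope.

Section random_variables.
Context (d : measure_display) (T : measurableType d) (R : realType).
Variable P : probability T R.

Definition norm_RV (p : R) (X : T -> R) : \bar R := Lnorm P p%:E (EFin \o X).

Definition hypercontractive (eta : R) (X : T -> R) : Prop :=
  [/\ (0 < norm_RV 4 X)%E, (norm_RV 4 X < +oo)%E &
      forall a : R,
        (norm_RV 4 (fun w => (a + eta * X w)%R) <= norm_RV 2 (fun w => (a + X w)%R))%E].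

Section families.
Variable I : finType.
Variable X : I -> {RV P >-> R}.

Definition independent_RVs (J : pred I) : Prop :=
  forall (K : {set I}) (A : I -> set R),
    {subset K <= J} -> (forall j, measurable (A j)) ->
    P (\bigcap_(j in [set` K]) (X j @^-1` A j)) =
      \big[*%E/1%E]_(j in K) P (X j @^-1` A j).

Definition pairwise_independent_RVs : Prop :=
  forall i j : I, i != j -> independent_RVs (pred2 i j).

Definition regular (delta : R) (J : pred I) : Prop :=
  (\sum_(j | J j) norm_RV 4 (X j) ^+ 4 <=
     delta%:E * (\sum_(j | J j) norm_RV 2 (X j) ^+ 2) ^+ 2)%E.

End families.

Section sequences.
Variables (n : nat) (X : 'I_n.+1 -> {RV P >-> R}).

Definition tail_from (i : nat) : pred 'I_n.+1 := fun j => (i <= j)%N.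

Definition sigma_sq (j : 'I_n.+1) : \bar R := (norm_RV 2 (X j) ^+ 2)%E.

Definition tau (i : nat) : \bar R :=
  sqrte (\sum_(j < n.+1 | tail_from i j) sigma_sq j)%E.

(* [None] stands for an infinite critical index. *)
Definition critical_index (delta : R) : option 'I_n.+1 :=
  [pick l : 'I_n.+1 | `[< regular X delta (tail_from l) /\
     forall i : 'I_n.+1, regular X delta (tail_from i) -> (l <= i)%N >]].

Definition critical_index_ge (delta : R) (L : nat) : Prop :=
  if critical_index delta is Some l then (L <= l)%N else True.

End sequences.
End random_variables.

Section parameters.
Context (R : realType).

(* [absz] of the ceiling: the arguments of [Num.ceil] are positive in the range
   of parameters considered. *)
Definition num_blocks (eta eps : R) : nat :=
  `|Num.ceil (2 / eta ^+ 4 * ln (1 / eps))|%N.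

Definition block_length (eta delta s : R) : nat :=
  `|Num.ceil (1 / (eta ^+ 4 * delta) * ln (1 + 16 * s ^+ 2))|%N.

Definition head_length (eta delta eps s : R) : nat :=
  (num_blocks eta eps * block_length eta delta s)%N.

End parameters.

(* Main.v *)
(* Write [v j] for the variances and [t i = \sum_(j >= i) v j].  Below the
   critical index regularity fails at every [i], and with
   [||x_j||_4^4 <= v_j^2 / eta^4] and the ordering this gives
   [t (i + 1) <= (1 - eta^4 delta) t i].  Hence over a block of length [r] the
   tail drops by a factor [1 + 16 s^2], so each block sum has standard deviation
   at least [4 s] times the root of the tail after it.  Hypercontractivity gives
   (Paley-Zygmund) that each block sum, whatever came before it, lands within
   half a standard deviation of a given point with probability at most
   [1 - 9/16 eta^4]; by independence all [b] partial sums stay close to [theta]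
   with probability at most [(1 - 9/16 eta^4)^b <= eps].  Otherwise the full sum
   can only return close to [theta] if some later remainder is large compared
   with its own tail, and Markov's inequality for the fourth moment bounds this
   by [1 / (eta^4 s^4)] for each of the [b = O(ln (1/eps) / eta^4)] blocks. *)
Require Import Defs.
From mathcomp Require Import measurable_realfun ring lra.

Set Implicit Arguments.
Unset Strict Implicit.
Unset Printing Implicit Defensive.

Import Order.TTheory GRing.Theory Num.Theory.
Import numFieldNormedType.Exports.

Local Open Scope classical_set_scope.
Local Open Scope ring_scope.

(** * Independence *)

Lemma measurable_preimageT d d' (T1 : measurableType d) (T2 : measurableType d')
    (f : T1 -> T2) (B : set T2) :
  measurable_fun setT f -> measurable B -> measurable (f @^-1` B).
Proof. by move=> mf mB; rewrite -[X in measurable X]setTI; exact: mf. Qed.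

Section independence.
Context (d : measure_display) (T : measurableType d) (R : realType).
Variable P : probability T R.

(** Dynkin's pi-lambda argument: the events independent of a fixed [B] form a Dynkin system. *)
Lemma g_sigma_algebra_indep (C : set (set T)) (B : set T) :
  setI_closed C -> C `<=` measurable -> measurable B ->
  (forall A, C A -> P (A `&` B) = (P A * P B)%E) ->
  forall A, <<s C >> A -> P (A `&` B) = (P A * P B)%E.
Proof.
move=> CI Cm mB CB.
pose H := [set A | measurable A /\ P (A `&` B) = (P A * P B)%E].
suff sub : <<s C >> `<=` H by move=> A /sub[].
rewrite -setI_closed_g_dynkin_g_sigma_algebra//.
apply: smallest_sub; last by move=> A CA; split; [exact: Cm|exact: CB].
split.
- by split => //; rewrite setTI probability_setT mul1e.
- move=> A [mA AB]; split; first exact: measurableC.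
  have -> : ~` A `&` B = B `\` (A `&` B).
    apply/seteqP; split => w /=; first by move=> [nA wB]; split => // -[].
    by move=> [wB nAB]; split => // wA; apply: nAB.
  have -> : P (B `\` (A `&` B)) = (P B - P A * P B)%E.
    rewrite -AB measureD//; [by rewrite setICA setIid|exact: measurableI|].
    by rewrite (le_lt_trans (probability_le1 _ _)) ?ltry.
  rewrite probability_setC// muleBl ?mul1e//; first exact: fin_num_measure.
- move=> F tF HF; have mF n : measurable (F n) by have [] := HF n.
  split; first exact: bigcup_measurable.
  rewrite setI_bigcupl measure_bigcup//; last 2 first.
  + by move=> n _; exact: measurableI.
  + exact: trivIset_setIr.
  have -> : P (\bigcup_n F n) = (\sum_(n <oo) P (F n))%E.
    by rewrite measure_bigcup//; apply: eq_eseriesl => n; rewrite in_setT.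
  rewrite muleC -(fineK (fin_num_measure P _ mB)) -nneseriesZl//.
  rewrite (@eq_eseriesl _ _ xpredT); last by move=> n; rewrite in_setT.
  apply: eq_eseriesr => n _; have [_ FB] := HF n.
  by rewrite fineK ?fin_num_measure// muleC.
Qed.

Section pairs.
Context (d1 : measure_display) (T1 : measurableType d1).
Variables (U : {mfun T >-> T1}) (Y : {mfun T >-> R}).
Hypothesis UY : forall A B, measurable A -> measurable B ->
  P (U @^-1` A `&` Y @^-1` B) = (P (U @^-1` A) * P (Y @^-1` B))%E.

Lemma measurable_pair : measurable_fun [set: T] (fun w => (U w, Y w)).
Proof. exact/measurable_fun_pair. Qed.

Let UxY : {mfun T >-> (T1 * R)%type} := mfun_Sub (mem_set measurable_pair).

(** By independence both measures agree on rectangles, which determine the product measure. *)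
Lemma joint_distribution (E : set (T1 * R)) : measurable E ->
  distribution P UxY E = (distribution P U \x distribution P Y)%E E.
Proof.
move=> mE; apply/esym.
by apply: product_measure_unique => // A B mA mB; exact: UY.
Qed.


(* The product measure is an integral over the values of [U], so a bound on [Y]
   uniform in the shift applies conditionally on [U]. *)
Lemma anticoncentration_step (A : set T1) (S : T1 -> R) (theta c q : R) :
  measurable A -> measurable_fun setT S ->
  (forall t : R, (P [set w | (`|Y w - t| <= c)%R] <= q%:E)%E) ->
  (P [set w | A (U w) /\ (`|S (U w) + Y w - theta| <= c)%R]
     <= q%:E * P (U @^-1` A))%E.
Proof.
move=> mA mS Yq.
pose E := [set z : T1 * R | A z.1 /\ `|S z.1 + z.2 - theta| <= c].
have mE : measurable E.
  have -> : E = (A `*` setT) `&`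
      (fun z : T1 * R => `|S z.1 + z.2 - theta|) @^-1` `]-oo, c].
    apply/seteqP; split=> -[u v] /=; first by move=> [uA h]; rewrite in_itv.
    by move=> [[uA _]]; rewrite in_itv.
  apply: measurableI; first exact: measurableX.
  apply: (@measurable_preimageT _ _ _ _ (fun z : T1 * R => `|S z.1 + z.2 - theta|)) => //.
  apply: measurableT_comp => //; apply: measurable_funB => //.
  by apply: measurable_funD => //; exact: measurableT_comp.
rewrite (_ : P _ = distribution P UxY E)//.
rewrite joint_distribution//= /product_measure1/=.
have mAE : measurable_fun setT (fun u => (\1_A u)%:E : \bar R).
  by apply/measurable_EFinP; exact: measurable_indic.
have q0 : 0 <= q.
  by rewrite -lee_fin (le_trans _ (Yq 0)).
apply: (@le_trans _ _ (\int[distribution P U]_u (q%:E * (\1_A u)%:E))%E).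
  apply: ge0_le_integral => //=.
  - exact: measurable_fun_xsection.
  - exact: measurable_funeM.
  (* For [u] in [A] the section of [E] is the window of radius [c] around [theta - S u]; otherwise
     it is empty. *)
  - move=> u _; rewrite indicE; have [/set_mem uA|uA] := boolP (u \in A).
      rewrite mule1; apply: le_trans (Yq (theta - S u)).
      rewrite /distribution /pushforward; apply: le_measure; rewrite ?inE.
      + apply: measurable_funPTI => //; exact: measurable_xsection.
      + rewrite (_ : [set w | _] = (fun w => `|Y w - (theta - S u)|) @^-1` `]-oo, c]).
          apply: measurable_preimageT => //.
          by apply: measurableT_comp => //; exact: measurable_funB.
        by apply/seteqP; split => w /=; rewrite in_itv.
      + move=> w; rewrite /= /xsection /= inE => -[_].
        by rewrite /= opprB addrA (addrC (Y w)).
    rewrite mule0 (_ : xsection _ _ = set0) ?measure0//.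
    apply/seteqP; split => // v; rewrite /xsection /= inE => -[/= uA' _].
    by move/negP: uA; apply; rewrite inE.
by rewrite ge0_integralZl// integral_indic// setIT.
Qed.

End pairs.

Section products.
Variables (S Y : {mfun T >-> R}).
Hypothesis SY : forall A B, measurable A -> measurable B ->
  P (S @^-1` A `&` Y @^-1` B) = (P (S @^-1` A) * P (Y @^-1` B))%E.
Hypotheses (iS : P.-integrable setT (EFin \o S))
           (iY : P.-integrable setT (EFin \o Y)).

Let f (z : R * R) : \bar R := (z.1 * z.2)%:E.

Let mf : measurable_fun setT f.
Proof. by apply/measurable_EFinP; exact: measurable_funM. Qed.

Let iS' : (distribution P S).-integrable setT EFin.
Proof. exact: (@integrable_pushforward _ _ _ _ _ S _ P setT EFin). Qed.

Let iY' : (distribution P Y).-integrable setT EFin.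
Proof. exact: (@integrable_pushforward _ _ _ _ _ Y _ P setT EFin). Qed.

(** Tonelli: the integral of [|x * y|] factors into the two finite first absolute moments. *)
Let ifp : (distribution P S \x distribution P Y)%E.-integrable setT f.
Proof.
apply/integrable12ltyP => //.
have mabs : measurable_fun setT (fun x : R => `|x%:E|%E).
  exact: measurableT_comp.
have -> : (fun x => \int[distribution P Y]_y `|f (x, y)|)%E =
          (fun x => `|x%:E| * \int[distribution P Y]_y `|y%:E|)%E.
  apply/funext => x; rewrite -ge0_integralZl//.
  by apply: eq_integral => y _; rewrite /f/= normrM EFinM.
move/integrableP: iY' => [_ hY]; move/integrableP: iS' => [_ hS].
rewrite ge0_integralZr ?integral_ge0//.
by rewrite lte_mul_pinfty// ?ge0_fin_numE// integral_ge0.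
Qed.

Let SxY : {mfun T >-> (R * R)%type} := mfun_Sub (mem_set (measurable_pair S Y)).

Let law (E : set (R * R)) : measurable E ->
  distribution P SxY E = (distribution P S \x distribution P Y)%E E.
Proof. exact: joint_distribution. Qed.

Lemma integrable_indep_mul : P.-integrable setT (EFin \o (S \* Y)).
Proof.
apply/integrableP; split.
  by apply/measurable_EFinP; exact: measurable_funM.
have mfa : measurable_fun setT (abse \o f) by exact: measurableT_comp.
have := @ge0_integral_distribution _ _ _ _ _ P SxY (abse \o f).
move=> /(_ mfa (fun z => abse_ge0 (f z))) <-.
rewrite (eq_measure_integral (distribution P S \x distribution P Y)%E); last first.
  by move=> E mE _; exact: law.
by have /integrableP[] := ifp.
Qed.

Lemma Rintegral_indep_mul :
  \int[P]_w (S w * Y w) = \int[P]_w S w * \int[P]_w Y w.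
Proof.
rewrite /Rintegral -fineM; last 2 first.
  exact: integrable_fin_num.
  exact: integrable_fin_num.
congr fine.
have := @integral_distribution _ _ _ _ _ P SxY _ mf integrable_indep_mul.
rewrite /comp /= => <-.
rewrite (eq_measure_integral (distribution P S \x distribution P Y)%E); last first.
  by move=> E mE _; exact: law.
have mEFin : measurable_fun setT (@EFin R) by exact/measurable_EFinP.
rewrite -integral12_prod_meas1// /fubini_F /=.
have := @integral_distribution _ _ _ _ _ P Y _ mEFin iY.
have := @integral_distribution _ _ _ _ _ P S _ mEFin iS.
rewrite /comp /= => <- <-.
have Yfin : (\int[distribution P Y]_y y%:E)%E \is a fin_num.
  exact: integrable_fin_num.
rewrite -(fineK Yfin) -integralZr//.
apply: eq_integral => x _; rewrite fineK// -integralZl//.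
Qed.

End products.
End independence.

(** * Moments *)

Section moments.
Context (d : measure_display) (T : measurableType d) (R : realType).
Variable P : probability T R.
Implicit Types f g S Y : T -> R.

(** Markov's inequality with an arbitrary test function; below, [g] is a polynomial of degree four
    in a block sum. *)
Lemma le_probability_Rintegral (A : set T) g :
  measurable A -> P.-integrable setT (EFin \o g) -> (forall w, 0 <= g w) ->
  (forall w, A w -> 1 <= g w) -> (P A <= (\int[P]_w g w)%:E)%E.
Proof.
move=> mA ig g0 Ag.
rewrite /Rintegral fineK ?(integrable_fin_num _ ig)//.
rewrite -[A in P A]setIT -integral_indic//.
apply: ge0_le_integral => //=.
- by apply/measurable_EFinP; exact: measurable_indic.
- by case/integrableP: ig.
- move=> w _; rewrite lee_fin indicE; have [/set_mem/Ag//|_] := boolP (w \in A).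
  exact: g0.
Qed.

Lemma Rintegral_sum (n : nat) (h : nat -> T -> R) :
  (forall i, (i < n)%N -> P.-integrable setT (EFin \o h i)) ->
  \int[P]_w (\sum_(i < n) h i w) = \sum_(i < n) \int[P]_w h i w.
Proof.
elim: n => [_|n IH ih].
  rewrite big_ord0 (_ : (fun _ => _) = cst 0) ?Rintegral_cst ?mul0r//.
  by apply/funext => w; rewrite big_ord0.
rewrite big_ord_recr/= -IH; last by move=> i /ltnW; exact: ih.
rewrite -RintegralD//; last exact: ih.
  by apply: eq_Rintegral => w _; rewrite big_ord_recr.
rewrite (_ : _ \o _ = (fun w => \sum_(i < n) (h i w)%:E)%E); last first.
  by apply/funext => w; rewrite /= sumEFin.
by apply: integrable_sum => // i _; apply: ih; rewrite ltnS ltnW.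
Qed.

(** Domination by [1 + f ^+ n], splitting according to whether [|f| <= 1]. *)
Lemma integrable_exp_le (f : T -> R) (n i : nat) : ~~ odd n -> (i <= n)%N ->
  measurable_fun setT f -> P.-integrable setT (fun w => (f w ^+ n)%:E) ->
  P.-integrable setT (fun w => (f w ^+ i)%:E).
Proof.
move=> on le_in mf fn.
have i1 : P.-integrable setT (fun w => (1 + f w ^+ n)%:E).
  apply: (@integrableD _ _ _ P setT _ (cst 1%:E) (fun w => (f w ^+ n)%:E)) => //.
  exact: finite_measure_integrable_cst.
apply: le_integrable i1 => //.
  by apply/measurable_EFinP; exact: measurable_funX.
move=> w _ /=; rewrite lee_fin normrX.
rewrite [leRHS]ger0_norm; last by rewrite addr_ge0// exprn_even_ge0.
have -> : f w ^+ n = `|f w| ^+ n by rewrite -normrX ger0_norm// exprn_even_ge0.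
have [f1|/ltW f1] := leP `|f w| 1.
  by rewrite (le_trans (exprn_ile1 i (normr_ge0 _) f1))// lerDl exprn_ge0.
by rewrite (le_trans (ler_weXn2l f1 le_in))// lerDr.
Qed.

(** Powers of independent variables are independent, so each mixed moment in the binomial expansion
    factors. *)
Lemma moment_add (S Y : {mfun T >-> R}) (n : nat) :
  (forall A B, measurable A -> measurable B ->
     P (S @^-1` A `&` Y @^-1` B) = (P (S @^-1` A) * P (Y @^-1` B))%E) ->
  (forall i, (i <= n)%N -> P.-integrable setT (fun w => (S w ^+ i)%:E)) ->
  (forall i, (i <= n)%N -> P.-integrable setT (fun w => (Y w ^+ i)%:E)) ->
  P.-integrable setT (fun w => ((S w + Y w) ^+ n)%:E) /\
  \int[P]_w ((S w + Y w) ^+ n) =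
    \sum_(i < n.+1) ((\int[P]_w (S w ^+ (n - i))) * (\int[P]_w (Y w ^+ i))) *+ 'C(n, i).
Proof.
move=> SY iS iY.
have prod i j : (i <= n)%N -> (j <= n)%N ->
    P.-integrable setT (fun w => (S w ^+ i * Y w ^+ j)%:E) /\
    \int[P]_w (S w ^+ i * Y w ^+ j) =
      (\int[P]_w (S w ^+ i)) * (\int[P]_w (Y w ^+ j)).
  move=> lin ljn.
  have mSi : measurable_fun setT (fun w => S w ^+ i) by exact: measurable_funX.
  have mYj : measurable_fun setT (fun w => Y w ^+ j) by exact: measurable_funX.
  pose Si : {mfun T >-> R} := mfun_Sub (mem_set mSi).
  pose Yj : {mfun T >-> R} := mfun_Sub (mem_set mYj).
  have SYij A B : measurable A -> measurable B ->
     P (Si @^-1` A `&` Yj @^-1` B) = (P (Si @^-1` A) * P (Yj @^-1` B))%E.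
    move=> mA mB.
    apply: (SY ((fun r => r ^+ i) @^-1` A) ((fun r => r ^+ j) @^-1` B)).
      by apply: measurable_preimageT => //; exact: exprn_measurable.
    by apply: measurable_preimageT => //; exact: exprn_measurable.
  split.
    exact: (integrable_indep_mul SYij (iS _ lin) (iY _ ljn)).
  exact: (Rintegral_indep_mul SYij (iS _ lin) (iY _ ljn)).
pose h i w := (S w ^+ (n - i) * Y w ^+ i) *+ 'C(n, i).
have hE i w : h i w = 'C(n, i)%:R * (S w ^+ (n - i) * Y w ^+ i).
  by rewrite mulr_natl.
have ih i : (i < n.+1)%N -> P.-integrable setT (EFin \o h i).
  move=> lin; have [ip _] := prod _ _ (leq_subr i n) lin.
  apply: eq_integrable (integrableZl measurableT 'C(n, i)%:R ip) => // w _.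
  by rewrite /= hE EFinM.
split.
  have := @integrable_sum _ _ _ P setT measurableT _ (index_enum 'I_n.+1) xpredT
    (fun i w => (h i w)%:E) (fun i _ => ih i (ltn_ord i)).
  apply: eq_integrable => // w _.
  by rewrite sumEFin exprDn.
transitivity (\int[P]_w (\sum_(i < n.+1) h i w)).
  by apply: eq_Rintegral => w _; rewrite exprDn.
rewrite Rintegral_sum//; apply: eq_bigr => -[i lin] _ /=.
have [ip <-] := prod _ _ (leq_subr i n) lin.
rewrite -mulr_natl -RintegralZl//.
by apply: eq_Rintegral => w _; rewrite hE.
Qed.

Lemma Rintegral_poly f (n : nat) (c : nat -> R) :
  (forall i, (i < n)%N -> P.-integrable setT (fun w => (f w ^+ i)%:E)) ->
  P.-integrable setT (fun w => (\sum_(i < n) c i * f w ^+ i)%:E) /\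
  \int[P]_w (\sum_(i < n) c i * f w ^+ i) =
    \sum_(i < n) c i * (\int[P]_w (f w ^+ i)).
Proof.
move=> i_f; pose h i w := c i * f w ^+ i.
have ih i : (i < n)%N -> P.-integrable setT (EFin \o h i).
  by move=> i_n; exact: eq_integrable (integrableZl measurableT (c i) (i_f i i_n)).
split.
  have := @integrable_sum _ _ _ P setT measurableT _ (index_enum 'I_n) xpredT
    (fun i w => (h i w)%:E) (fun i _ => ih i (ltn_ord i)).
  by apply: eq_integrable => // w _; rewrite sumEFin.
rewrite (Rintegral_sum ih); apply: eq_bigr => -[i i_n] _ /=.
by rewrite RintegralZl//; exact: i_f.
Qed.

Lemma Rintegral_exp0 f : \int[P]_w (f w ^+ 0) = 1.
Proof.
rewrite (_ : (fun _ => _) = cst 1)// Rintegral_cst//.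
by rewrite [X in fine X](_ : _ = 1%E) ?mulr1//; exact: probability_setT.
Qed.

Lemma Rintegral_exp1 f : \int[P]_w (f w ^+ 1) = \int[P]_w f w.
Proof. by apply: eq_Rintegral => w _; rewrite expr1. Qed.

End moments.

(** * Blocks of independent variables *)

Section blocks.
Context (d : measure_display) (T : measurableType d) (R : realType).
Variables (P : probability T R) (x : nat -> {RV P >-> R}) (L : nat).

(** Constraining all [L] variables at once also covers subfamilies: take [A j = setT] for the
    others. *)
Definition independent_upto := forall A : nat -> set R,
  (forall j, measurable (A j)) ->
  P [set w | forall j, (j < L)%N -> A j (x j w)] =
    (\big[*%E/1%E]_(j < L) P (x j @^-1` A j))%E.

Definition cylinder (a b : nat) (A : nat -> set R) : set T :=
  [set w | forall j, (a <= j < b)%N -> A j (x j w)].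

(** A pi-system generating the sigma-algebra of the variables with index in [[a, b)]. *)
Definition cylinders (a b : nat) : set (set T) :=
  [set cylinder a b A | A in [set A | forall j, measurable (A j)]].

Lemma cylinders_setI_closed a b : setI_closed (cylinders a b).
Proof.
move=> _ _ [A mA <-] [B mB <-]; exists (fun j => A j `&` B j).
  by move=> j; exact: measurableI.
apply/seteqP; split => w /=.
  by move=> AB; split => j /AB[].
by move=> [Aw Bw] j jab; split; [exact: Aw|exact: Bw].
Qed.

Lemma measurable_cylinder a b A :
  (forall j, measurable (A j)) -> measurable (cylinder a b A).
Proof.
move=> mA.
have -> : cylinder a b A =
    \bigcap_(j in [set j | (a <= j < b)%N]) (x j @^-1` A j) by [].
by apply: bigcap_measurableType => j _; exact: measurable_funPTI.
Qed.

Lemma cylinders_measurable a b : cylinders a b `<=` measurable.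
Proof. by move=> _ [A mA <-]; exact: measurable_cylinder. Qed.

Lemma g_cylinders_measurable a b : <<s cylinders a b >> `<=` measurable.
Proof.
by apply: smallest_sub; [exact: sigma_algebra_measurable|exact: cylinders_measurable].
Qed.

Hypothesis indep : independent_upto.

(** The product runs over all [j < L], with factor 1 outside the range, so that cylinders over
    adjacent ranges multiply factor by factor. *)
Lemma probability_cylinder a b A : (b <= L)%N ->
  (forall j, measurable (A j)) ->
  P (cylinder a b A) =
    (\big[*%E/1%E]_(j < L) if (a <= j < b)%N then P (x j @^-1` A j) else 1%E)%E.
Proof.
move=> bL mA.
pose A' j := if (a <= j < b)%N then A j else setT.
have -> : cylinder a b A = [set w | forall j, (j < L)%N -> A' j (x j w)].
  apply/seteqP; split => w /= Aw j.
    by move=> _; rewrite /A'; case: ifPn => // /Aw.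
  move=> jab; have := Aw j; rewrite /A' jab; apply.
  by case/andP: jab => _ /leq_trans; exact.
rewrite indep; last by move=> j; rewrite /A'; case: ifPn.
apply: eq_bigr => j _; rewrite /A'; case: ifPn => // _.
by rewrite preimage_setT probability_setT.
Qed.

Lemma cylinder_indep a c b A B : (a <= c)%N -> (c <= b)%N -> (b <= L)%N ->
  (forall j, measurable (A j)) -> (forall j, measurable (B j)) ->
  P (cylinder a c A `&` cylinder c b B) =
    (P (cylinder a c A) * P (cylinder c b B))%E.
Proof.
move=> ac cb bL mA mB.
have -> : cylinder a c A `&` cylinder c b B =
    cylinder a b (fun j => if (j < c)%N then A j else B j).
  apply/seteqP; split => w /=.
    move=> [Aw Bw] j /andP[aj jb]; case: ltnP => jc.
      by apply: Aw; rewrite aj.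
    by apply: Bw; rewrite jc.
  move=> ABw; split => j /andP[j1 j2].
    by have := ABw j; rewrite j1 j2 (leq_trans j2 cb); exact.
  by have := ABw j; rewrite (leq_trans ac j1) j2 ltnNge j1; exact.
rewrite !probability_cylinder//; [|exact: leq_trans cb bL|]; last first.
  by move=> j; case: ifPn.
rewrite -big_split/=; apply: eq_bigr => j _.
case: (ltnP j c) => jc.
  by rewrite (leq_trans jc cb) /= mule1.
by rewrite (leq_trans ac jc) /= mul1e.
Qed.

(** The pi-lambda argument is applied twice, extending first one side and then the other from
    cylinders to the generated sigma-algebra. *)
Lemma g_cylinders_indep a c b A B : (a <= c)%N -> (c <= b)%N -> (b <= L)%N ->
  <<s cylinders a c >> A -> <<s cylinders c b >> B ->
  P (A `&` B) = (P A * P B)%E.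
Proof.
move=> ac cb bL sA sB.
have mB : measurable B := g_cylinders_measurable sB.
apply: (@g_sigma_algebra_indep _ _ _ P _ B (@cylinders_setI_closed a c)
  (@cylinders_measurable a c) mB _ A sA) => _ [A' mA' <-].
rewrite setIC muleC.
apply: (@g_sigma_algebra_indep _ _ _ P _ _ (@cylinders_setI_closed c b)
  (@cylinders_measurable c b) (measurable_cylinder _ _ mA') _ B sB) => _ [B' mB' <-].
by rewrite setIC muleC; exact: cylinder_indep.
Qed.

Definition block_sum (a b : nat) (w : T) : R := \sum_(a <= j < b) x j w.

Lemma measurable_block_sum a b a' b' : (a <= a')%N -> (b' <= b)%N ->
  measurable_fun [set: g_sigma_algebraType (cylinders a b)] (block_sum a' b').
Proof.
move=> aa bb.
(* Summands outside the range are replaced by 0, since every summand has to be measurable for the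
   smaller sigma-algebra. *)
have -> : block_sum a' b' =
    fun w => \sum_(j <- index_iota a' b') (if (a' <= j < b')%N then x j w else 0).
  by apply/funext => w; rewrite /block_sum; apply: eq_big_nat => j ->.
apply: (@measurable_sum _ (g_sigma_algebraType (cylinders a b))) => j.
case: (boolP (a' <= j < b')%N) => [/andP[aj jb]|_]; last exact: measurable_cst.
move=> _ B mB; rewrite setTI; apply: sub_sigma_algebra.
exists (fun i => if i == j then B else setT).
  by move=> i; case: ifPn.
apply/seteqP; split => w /=.
  move=> /(_ j); rewrite eqxx; apply.
  by rewrite (leq_trans aa aj) (leq_trans jb bb).
by move=> Bw i _; case: eqP => [->|].
Qed.

Lemma measurable_block_sumT a b : measurable_fun setT (block_sum a b).
Proof.
by apply: measurable_sum => j.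
Qed.

Lemma block_sum_indep a c b (A : set T) (B : set R) :
  (a <= c)%N -> (c <= b)%N -> (b <= L)%N ->
  <<s cylinders a c >> A -> measurable B ->
  P (A `&` block_sum c b @^-1` B) = (P A * P (block_sum c b @^-1` B))%E.
Proof.
move=> ac cb bL sA mB; apply: (g_cylinders_indep ac cb bL sA).
exact: (@measurable_preimageT _ _ (g_sigma_algebraType (cylinders c b))
  _ _ _ (@measurable_block_sum c b c b (leqnn c) (leqnn b)) mB).
Qed.

Lemma block_sum2_indep a c b (A B : set R) :
  (a <= c)%N -> (c <= b)%N -> (b <= L)%N -> measurable A -> measurable B ->
  P (block_sum a c @^-1` A `&` block_sum c b @^-1` B) =
    (P (block_sum a c @^-1` A) * P (block_sum c b @^-1` B))%E.
Proof.
move=> ac cb bL mA mB; apply: (@block_sum_indep a) => //.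
exact: (@measurable_preimageT _ _ (g_sigma_algebraType (cylinders a c))
  _ _ _ (@measurable_block_sum a c a c (leqnn a) (leqnn c)) mA).
Qed.

(** Given the past, the next block sum must hit a window whose centre depends only on that past;
    each block thus costs a factor [q]. *)
Lemma prefix_anticoncentration (r b : nat) (theta q : R) (c : nat -> R) :
  (b * r <= L)%N -> 0 <= q ->
  (forall k t, (k < b)%N ->
     (P [set w | (`|block_sum (k * r) (k.+1 * r) w - t| <= c k)%R] <= q%:E)%E) ->
  (P [set w | forall k, (k < b)%N -> (`|block_sum 0 (k.+1 * r) w - theta| <= c k)%R]
    <= (q ^+ b)%:E)%E.
Proof.
move=> bL q0 hq.
pose E m := [set w | forall k, (k < m)%N ->
  `|block_sum 0 (k.+1 * r) w - theta| <= c k].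
(* The induction also records that [E m] depends on the first [m] blocks only, hence is independent
   of the next one. *)
suff H m : (m <= b)%N -> <<s cylinders 0 (m * r) >> (E m) /\ (P (E m) <= (q ^+ m)%:E)%E.
  by have [] := H b (leqnn b).
elim: m => [_|m IH mb].
  have -> : E 0%N = setT by apply/seteqP; split.
  split; last by rewrite expr0 probability_le1.
  exact: (@measurableT _ (g_sigma_algebraType (cylinders 0 (0 * r)))).
have [sE PE] := IH (ltnW mb).
have mle : (m * r <= m.+1 * r)%N by rewrite leq_mul2r leqnSn orbT.
have mL : (m.+1 * r <= L)%N by rewrite (leq_trans _ bL)// leq_mul2r mb orbT.
have sF k : (k <= m)%N -> <<s cylinders 0 (m.+1 * r) >>
    [set w | `|block_sum 0 (k.+1 * r) w - theta| <= c k].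
  move=> km; rewrite (_ : [set w | _] =
      (fun w => `|block_sum 0 (k.+1 * r) w - theta|) @^-1` `]-oo, c k]); last first.
    by apply/seteqP; split => w /=; rewrite in_itv.
  apply: (@measurable_preimageT _ _ (g_sigma_algebraType (cylinders 0 (m.+1 * r)))) => //.
  apply: measurableT_comp => //; apply: measurable_funB => //.
  by apply: measurable_block_sum => //; rewrite leq_mul2r ltnS km orbT.
split.
  rewrite (_ : E m.+1 = \bigcap_(k in [set k | (k < m.+1)%N])
     [set w | `|block_sum 0 (k.+1 * r) w - theta| <= c k])//.
  apply: (@bigcap_measurableType _ (g_sigma_algebraType (cylinders 0 (m.+1 * r)))) => k /=.
  by rewrite ltnS => /sF.
(* The past is encoded as the identity map [U] into [T] carrying the sigma-algebra of the first [m]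
   blocks. *)
pose G := g_sigma_algebraType (cylinders 0 (m * r)).
have mid : measurable_fun setT (id : T -> G).
  move=> _ B mB; rewrite setTI; exact: (g_cylinders_measurable mB).
pose U : {mfun T >-> G} := mfun_Sub (mem_set mid).
pose Y : {mfun T >-> R} := mfun_Sub (mem_set (measurable_block_sumT (m * r) (m.+1 * r))).
have UY A B : measurable A -> measurable B ->
    P (U @^-1` A `&` Y @^-1` B) = (P (U @^-1` A) * P (Y @^-1` B))%E.
  by move=> mA mB; apply: (@block_sum_indep 0 (m * r)).
have := anticoncentration_step UY (A := E m) (S := block_sum 0 (m * r)) theta (c := c m)
   (q := q) sE (@measurable_block_sum 0 (m * r) 0 (m * r) (leqnn _) (leqnn _)) (fun t => hq m t mb).
move=> h; apply: (@le_trans _ _ (q%:E * P (E m))%E); last first.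
  by rewrite exprS EFinM lee_pmul// measure_ge0.
apply: le_trans h; rewrite le_eqVlt; apply/orP; left; apply/eqP; congr (P _).
have cat w : block_sum 0 (m.+1 * r) w = block_sum 0 (m * r) w + block_sum (m * r) (m.+1 * r) w.
  by rewrite /block_sum -big_cat_nat.
apply/seteqP; split => w /=.
  move=> Ew; split; first by move=> k km; apply: Ew; rewrite ltnW.
  by have := Ew m (ltnSn m); rewrite cat.
move=> [Ew Fw] k; rewrite ltnS leq_eqVlt => /predU1P[->|]; last exact: Ew.
by rewrite cat.
Qed.

End blocks.

(** * Hypercontractivity in terms of moments *)

Section hc_moments.
Context (d : measure_display) (T : measurableType d) (R : realType).
Variables (P : probability T R) (eta : R).
Implicit Types (f : T -> R) (v : R).

(* The part of hypercontractivity used below.  Subtracting the terms common to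
   [E (a + eta f)^4 <= (E (a + f)^2)^2] leaves an inequality in which only the
   fourth moment fails to be additive over independent summands, and its cross
   terms are absorbed by [v ^+ 2]. *)
Definition hc_moments f v := [/\ measurable_fun setT f,
  forall i, (i <= 4)%N -> P.-integrable setT (fun w => (f w ^+ i)%:E),
  \int[P]_w f w = 0,
  \int[P]_w (f w ^+ 2) = v &
  forall a, 6 * a ^+ 2 * eta ^+ 2 * v + 4 * a * eta ^+ 3 * (\int[P]_w (f w ^+ 3))
    + eta ^+ 4 * (\int[P]_w (f w ^+ 4)) <= 2 * a ^+ 2 * v + v ^+ 2].

Lemma hc_moments0 : hc_moments (fun=> 0) 0.
Proof.
have e i : (fun w : T => ((0 : R) ^+ i.+1)) = cst 0.
  by apply/funext => w; rewrite exprS mul0r.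
split.
- exact: measurable_cst.
- by move=> i _; exact: (finite_measure_integrable_cst P (0 ^+ i)).
- by rewrite Rintegral_cst// mul0r.
- by rewrite e Rintegral_cst// mul0r.
- by move=> a; rewrite !e Rintegral_cst// mul0r !mulr0 expr0n !addr0.
Qed.

(** Variances and centred third moments add. The fourth moment gains [6 * v * v'], whose multiple by
    [eta ^+ 4] is absorbed by the [2 * v * v'] in [(v + v') ^+ 2] because [3 * eta ^+ 4 <= 1]. *)
Lemma hc_moments_add (S Y : {mfun T >-> R}) v v' :
  3 * eta ^+ 4 <= 1 -> 0 <= v -> 0 <= v' ->
  (forall A B, measurable A -> measurable B ->
     P (S @^-1` A `&` Y @^-1` B) = (P (S @^-1` A) * P (Y @^-1` B))%E) ->
  hc_moments S v -> hc_moments Y v' -> hc_moments (fun w => S w + Y w) (v + v').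
Proof.
move=> eta3 v0 v'0 SY [mS iS S1 S2 hS] [mY iY Y1 Y2 hY].
have M n : (n <= 4)%N -> _ := fun n4 => moment_add SY
  (fun i i_n => iS i (leq_trans i_n n4)) (fun i i_n => iY i (leq_trans i_n n4)).
split.
- exact: measurable_funD.
- by move=> i /M[].
- have [_] := M 1%N isT.
  rewrite !big_ord_recr big_ord0/= !(Rintegral_exp1, Rintegral_exp0) S1 Y1 => ->.
  by rewrite !(mul0r, mulr0, mul0rn, addr0).
- have [_ ->] := M 2 isT.
  rewrite !big_ord_recr big_ord0/= !(Rintegral_exp1, Rintegral_exp0) S1 Y1 S2 Y2.
  by rewrite /binomial/=; ring.
- move=> a.
  have [_ ->] := M 3 isT; have [_ ->] := M 4 isT.
  rewrite !big_ord_recr !big_ord0/= !(Rintegral_exp1, Rintegral_exp0) S1 Y1 S2 Y2.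
  have := hS a; have := hY a; have := mulr_ge0 v0 v'0.
  rewrite /binomial/=.
  set s3 := \int[P]_w (S w ^+ 3); set s4 := \int[P]_w (S w ^+ 4).
  set y3 := \int[P]_w (Y w ^+ 3); set y4 := \int[P]_w (Y w ^+ 4).
  move=> vv h1 h2.
  have : 3 * eta ^+ 4 * (v * v') <= 1 * (v * v') by rewrite ler_wpM2r.
  nra.
Qed.

Lemma hc_moments_block_sum (x : nat -> {RV P >-> R}) (v : nat -> R) (L a b : nat) :
  3 * eta ^+ 4 <= 1 -> independent_upto x L ->
  (forall j, (j < L)%N -> 0 <= v j /\ hc_moments (x j) (v j)) ->
  (b <= L)%N -> hc_moments (block_sum x a b) (\sum_(a <= j < b) v j).
Proof.
move=> eta3 ind hx.
have empty m : (m <= a)%N -> hc_moments (block_sum x a m) (\sum_(a <= j < m) v j).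
  move=> ma; rewrite big_geq//.
  rewrite (_ : block_sum x a m = fun=> 0); first exact: hc_moments0.
  by apply/funext => w; rewrite /block_sum big_geq.
elim: b => [_|b IH bL]; first exact: empty.
have [ab|] := leqP a b; last exact: empty.
have [v0 hb] := hx b bL.
have IHb := IH (ltnW bL).
rewrite big_nat_recr//=.
pose S : {mfun T >-> R} := mfun_Sub (mem_set (measurable_block_sumT x a b)).
rewrite (_ : block_sum x a b.+1 = fun w => S w + x b w); last first.
  by apply/funext => w; rewrite /block_sum big_nat_recr.
apply: hc_moments_add => //.
- rewrite big_nat_cond sumr_ge0// => j /andP[/andP[_ jb] _].
  by have [] := hx j (ltn_trans jb bL).
- move=> A B mA mB.
  have := block_sum2_indep ind ab (leqnSn b) bL mA mB.
  by rewrite (_ : block_sum x b b.+1 = x b)//; apply/funext => w; rewrite /block_sum big_nat1.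
Qed.

(** Otherwise the terms in [a ^+ 2] would violate the moment inequality for large [a]. *)
Lemma hc_moments_eta f v : 0 < v -> hc_moments f v -> 3 * eta ^+ 2 <= 1.
Proof.
move=> v0 [_ _ _ _ h]; rewrite leNgt; apply/negP => eta1.
set m3 := Rintegral _ _ _ in h; set m4 := Rintegral _ _ (fun=> _ ^+ 4) in h.
have k0 : 0 < (6 * eta ^+ 2 - 2) * v by rewrite mulr_gt0//; lra.
set k := _ * v in k0; pose D := v ^+ 2 - eta ^+ 4 * m4.
(* Averaging the inequalities at [a] and [- a] removes the third moment. *)
have hD a : a ^+ 2 * k <= D.
  by have := h a; have := h (- a); rewrite /D /k; nra.
have D0 : 0 <= D by have := hD 0; rewrite expr0n/= mul0r.
have t0 : 0 <= D / k by rewrite divr_ge0// ltW.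
have := hD (D / k + 1).
have -> : (D / k + 1) ^+ 2 * k = D * (D / k) + 2 * D + k.
  by field; rewrite gt_eqF.
have := mulr_ge0 D0 t0; lra.
Qed.

Lemma hc_moments_fourth f v : hc_moments f v ->
  eta ^+ 4 * (\int[P]_w (f w ^+ 4)) <= v ^+ 2.
Proof. by move=> [_ _ _ _ /(_ 0)]; rewrite expr0n/=; lra. Qed.

(** Paley-Zygmund for [(f - t) ^+ 2]: its mean is at least [v], hence at least [4 * c ^+ 2], and its
    second moment is at most the squared mean over [eta ^+ 4]. The factor 9/16 is
    [(1 - 1 / 4) ^+ 2]. *)
Lemma hc_moments_anticoncentration f v c t :
  0 < eta < 1 -> 0 < v -> 4 * c ^+ 2 <= v -> hc_moments f v ->
  (P [set w | (`|f w - t| <= c)%R] <= (1 - 9 / 16 * eta ^+ 4)%:E)%E.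
Proof.
move=> /andP[eta0 eta1] v0 cv hf.
have [mf i_f f1 f2 h] := hf.
pose m := t ^+ 2 + v; pose lam := 3 / 4 * eta ^+ 4 / m.
have m0 : 0 < m by rewrite /m; have := sqr_ge0 t; lra.
pose u := 1 - lam * (t ^+ 2 - m / 4).
(* With [m = E (f - t)^2], the square [(1 - lam * ((f - t)^2 - m / 4))^2]
   dominates the indicator of [|f - t| <= c]; [lam] minimizes its mean (up to
   the fourth-moment bound) and [co] lists its coefficients in [f]. *)
pose co := nth 0 [:: u ^+ 2; 4 * lam * t * u; 4 * lam ^+ 2 * t ^+ 2 - 2 * lam * u;
                   - 4 * lam ^+ 2 * t; lam ^+ 2].
have gE w : \sum_(i < 5) co i * f w ^+ i = (1 - lam * ((f w - t) ^+ 2 - m / 4)) ^+ 2.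
  by rewrite !big_ord_recr big_ord0 /co /u/=; ring.
have [ig gI] := Rintegral_poly (n := 5) co i_f.
have lam0 : 0 <= lam by rewrite /lam !mulr_ge0// ?exprn_ge0 ?invr_ge0// ltW.
apply: (@le_trans _ _ (\int[P]_w (\sum_(i < 5) co i * f w ^+ i))%:E).
  apply: le_probability_Rintegral => //.
  - rewrite (_ : [set w | _] = (fun w => `|f w - t|) @^-1` `]-oo, c]); last first.
      by apply/seteqP; split => w /=; rewrite in_itv.
    apply: measurable_preimageT => //.
    by apply: measurableT_comp => //; exact: measurable_funB.
  - by move=> w; rewrite gE sqr_ge0.
  - move=> w /= fc; rewrite gE; apply: exprn_ege1.
    have c0 : 0 <= c by exact: le_trans fc.
    have : (f w - t) ^+ 2 <= c ^+ 2.
      by rewrite -real_normK ?num_real// lerXn2r ?nnegrE.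
    have := sqr_ge0 t.
    move=> t0 fc2.
    have : 0 <= lam * (m / 4 - (f w - t) ^+ 2).
      by rewrite mulr_ge0// /m; lra.
    lra.
rewrite lee_fin gI !big_ord_recr big_ord0 Rintegral_exp0 Rintegral_exp1 f1 f2 /co/=.
set m3 := Rintegral _ _ _ in h *; set m4 := Rintegral _ _ (fun=> _ ^+ 4) in h *.
(* The bracket is the fourth moment of [f - t]; the bound is the moment inequality at
   [a = - (eta * t)], weakened using [eta <= 1]. *)
have e4 : eta ^+ 4 * (t ^+ 4 + 6 * t ^+ 2 * v - 4 * t * m3 + m4) <= m ^+ 2.
  have := h (- (eta * t)); rewrite /m.
  have eta21 : eta ^+ 2 <= 1 by rewrite exprn_ile1// ltW.
  have : 0 <= (1 - eta ^+ 2) * (t ^+ 2 * v) by rewrite mulr_ge0 ?subr_ge0// mulr_ge0 ?sqr_ge0 ?ltW.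
  have : eta ^+ 4 * t ^+ 4 <= t ^+ 4.
    by rewrite ler_piMl ?exprn_even_ge0// exprn_ile1// ltW.
  nra.
set Z := t ^+ 4 + _ - _ + _ in e4.
rewrite [X in X <= _](_ : _ = 1 - 3 / 2 * (lam * m) + lam ^+ 2 * (Z - 7 / 16 * m ^+ 2)); last first.
  by rewrite /u /Z /m; field.
have lm : lam * m = 3 / 4 * eta ^+ 4 by rewrite /lam; field; rewrite gt_eqF.
have l2Z : lam ^+ 2 * Z <= 9 / 16 * eta ^+ 4.
  have -> : 9 / 16 * eta ^+ 4 = (3 / 4) ^+ 2 * eta ^+ 4 / m ^+ 2 * m ^+ 2.
    by field; rewrite gt_eqF.
  have -> : lam ^+ 2 * Z = (3 / 4) ^+ 2 * eta ^+ 4 / m ^+ 2 * (eta ^+ 4 * Z).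
    by rewrite /lam; field; rewrite gt_eqF.
  rewrite ler_wpM2l// !mulr_ge0// ?invr_ge0 ?exprn_ge0// ltW//.
(* What remains is [1 - 9/8 eta^4 + 9/16 eta^4], after dropping the negative term in [7 / 16]. *)
rewrite lm.
have : 0 <= lam ^+ 2 * m ^+ 2 by rewrite mulr_ge0 ?sqr_ge0.
lra.
Qed.

Lemma hc_moments_tail f v u : 0 < eta -> 0 < u -> hc_moments f v ->
  (P [set w | (u < `|f w|)%R] <= (v ^+ 2 / (eta ^+ 4 * u ^+ 4))%:E)%E.
Proof.
move=> eta0 u0 hf; have [mf i_f _ _ _] := hf.
apply: (@le_trans _ _ (\int[P]_w (u ^- 4 * f w ^+ 4))%:E).
  apply: le_probability_Rintegral.
  - rewrite (_ : [set w | _] = (fun w => `|f w|) @^-1` `]u, +oo[); last first.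
      by apply/seteqP; split => w /=; rewrite in_itv/= andbT.
    by apply: measurable_preimageT => //; exact: measurableT_comp.
  - exact: (integrableZl measurableT (u ^- 4) (i_f 4 isT)).
  - by move=> w; rewrite mulr_ge0// ?invr_ge0 ?exprn_even_ge0.
  - move=> w /= uf; rewrite mulrC ler_pdivlMr ?exprn_gt0// mul1r.
    rewrite (_ : f w ^+ 4 = `|f w| ^+ 4); last by rewrite -normrX ger0_norm// exprn_even_ge0.
    by rewrite lerXn2r ?nnegrE ?normr_ge0 ?ltW.
rewrite lee_fin RintegralZl//; last exact: (i_f 4 isT).
rewrite mulrC ler_pdivrMr ?exprn_gt0// -mulrA.
rewrite (_ : _ * u ^+ 4 = eta ^- 4); last first.
  by field; rewrite !gt_eqF.
by rewrite ler_pdivlMr ?exprn_gt0// mulrC; exact: hc_moments_fourth hf.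
Qed.

End hc_moments.

(** A cubic with nonzero leading term takes positive values; [a] to [- a] reduces to [0 < p]. *)
Lemma cubic_le0_lead (R : realFieldType) (p q r s : R) :
  (forall a, p * a ^+ 3 + q * a ^+ 2 + r * a + s <= 0) -> p = 0.
Proof.
wlog p0 : p q r s / 0 < p.
  move=> H h; have [p0|p0|//] := ltgtP 0 p; first exact: H h.
  have : - p = 0.
    apply: (H (- p) q (- r) s); first by rewrite oppr_gt0.
    by move=> a; apply: le_trans (h (- a)); lra.
  by move/eqP; rewrite oppr_eq0 => /eqP.
move=> h; exfalso.
pose K := `|q| + `|r| + `|s|.
have K0 : 0 <= K by rewrite /K !addr_ge0.
have Kp : 0 <= K / p by rewrite divr_ge0// ltW.
(* At this point [p * a ^+ 3 = (K + p) * a ^+ 2], while the lower terms are at least [- K * a ^+ 2]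
   since [1 <= a]. *)
have := h (K / p + 1); set a := K / p + 1.
have a1 : 1 <= a by rewrite /a; lra.
have pa : p * a = K + p by rewrite /a; field; rewrite gt_eqF.
have a2 : a <= a ^+ 2 by rewrite expr2 ler_peMl// (le_trans ler01).
have -> : p * a ^+ 3 = (K + p) * a ^+ 2 by rewrite -pa; ring.
have hq : - `|q| * a ^+ 2 <= q * a ^+ 2.
  by rewrite ler_wpM2r ?sqr_ge0// lerNnormlW.
have hr : - `|r| * a ^+ 2 <= r * a.
  have : - `|r| * a <= r * a.
    by rewrite ler_wpM2r ?(le_trans ler01)// lerNnormlW.
  by have := ler_wpM2l (normr_ge0 r) a2; lra.
have hs : - `|s| * a ^+ 2 <= s.
  have : - `|s| <= s by rewrite lerNnormlW.
  have a21 : 1 <= a ^+ 2 by exact: le_trans a1 a2.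
  by have := ler_wpM2l (normr_ge0 s) a21; lra.
have : 0 < p * a ^+ 2 by rewrite mulr_gt0// exprn_gt0// (lt_le_trans ltr01).
rewrite /K; nra.
Qed.

(** * From norms in the extended reals to real moments *)

Section norms.
Context (d : measure_display) (T : measurableType d) (R : realType).
Variable P : probability T R.

Lemma expeyS n : (+oo ^+ n.+1 = +oo :> \bar R)%E.
Proof. by elim: n => [//|n IH]; rewrite expeS IH mulyy. Qed.

Lemma norm_RV_exp (n : nat) (f : T -> R) :
  (norm_RV P n.+1%:R f ^+ n.+1 = \int[P]_w (`|f w| ^+ n.+1)%:E)%E.
Proof.
have n0 : n.+1%:R != 0 :> R by rewrite pnatr_eq0.
have := poweR_Lnorm P (EFin \o f) n0; rewrite -/(norm_RV P n.+1%:R f).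
rewrite (eq_integral (fun w => (`|f w| ^+ n.+1)%:E)); last first.
  by move=> w _; rewrite /comp abse_EFin poweR_EFin powR_mulrn.
move=> <-; have : (0 <= norm_RV P n.+1%:R f)%E by exact: Lnorm_ge0.
case: (norm_RV P n.+1%:R f) => [r r0| _|//].
  by rewrite poweR_EFin powR_mulrn// EFin_expe.
by rewrite poweRyr// expeyS.
Qed.

Lemma norm_RV_even (n : nat) (f : T -> R) : ~~ odd n.+1 ->
  P.-integrable setT (fun w => (f w ^+ n.+1)%:E) ->
  (norm_RV P n.+1%:R f ^+ n.+1 = (\int[P]_w (f w ^+ n.+1))%R%:E)%E.
Proof.
move=> en i_f; rewrite norm_RV_exp /Rintegral fineK; last exact: integrable_fin_num.
apply: eq_integral => w _; congr EFin.
by rewrite -normrX ger0_norm// exprn_even_ge0.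
Qed.

Variables (eta : R) (X : {RV P >-> R}).
Hypotheses (eta01 : 0 < eta < 1) (hX : hypercontractive P eta X).

Lemma hypercontractive_integrable i : (i <= 4)%N ->
  P.-integrable setT (fun w => (X w ^+ i)%:E).
Proof.
move=> i4; apply: (@integrable_exp_le _ _ _ P X 4) => //.
have mX4 : measurable_fun setT (fun w => (X w ^+ 4)%:E).
  by apply/measurable_EFinP; exact: measurable_funX.
apply/integrableP; split => //.
have [_ n4 _] := hX.
have := norm_RV_exp 3 X; rewrite (_ : (fun _ => _) = (fun w => `|(X w ^+ 4)%:E|%E)).
  move=> <-; move: n4; have : (0 <= norm_RV P 4 X)%E by exact: Lnorm_ge0.
  by case: (norm_RV P 4 X) => // r _ _; rewrite -EFin_expe ltry.
by apply/funext => w /=; rewrite normrX.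
Qed.

Let M (i : nat) := \int[P]_w (X w ^+ i).

(** The fourth power of the hypercontractive inequality, with both sides expanded in the moments of
    [X]. *)
Let shifted_moments a :
  a ^+ 4 + 4 * a ^+ 3 * eta * M 1%N + 6 * a ^+ 2 * eta ^+ 2 * M 2%N
    + 4 * a * eta ^+ 3 * M 3%N + eta ^+ 4 * M 4%N
  <= (a ^+ 2 + 2 * a * M 1%N + M 2%N) ^+ 2.
Proof.
have M0 : M 0%N = 1 by exact: Rintegral_exp0.
pose c4 := nth 0 [:: a ^+ 4; 4 * a ^+ 3 * eta; 6 * a ^+ 2 * eta ^+ 2;
                     4 * a * eta ^+ 3; eta ^+ 4].
pose c2 := nth 0 [:: a ^+ 2; 2 * a; 1].
have [i4 I4] := Rintegral_poly (n := 5) c4 hypercontractive_integrable.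
have [i2 I2] := Rintegral_poly (n := 3) c2
  (fun i i2 => hypercontractive_integrable (leq_trans i2 (isT : (3 <= 5)%N))).
have E4 w : \sum_(i < 5) c4 i * X w ^+ i = (a + eta * X w) ^+ 4.
  by rewrite !big_ord_recr big_ord0 /c4/=; ring.
have E2 w : \sum_(i < 3) c2 i * X w ^+ i = (a + X w) ^+ 2.
  by rewrite !big_ord_recr big_ord0 /c2/=; ring.
have {}i4 : P.-integrable setT (fun w => ((a + eta * X w) ^+ 4)%:E).
  by apply: eq_integrable i4 => // w _; rewrite E4.
have {}i2 : P.-integrable setT (fun w => ((a + X w) ^+ 2)%:E).
  by apply: eq_integrable i2 => // w _; rewrite E2.
have {E4}I4 : \int[P]_w ((a + eta * X w) ^+ 4) = \sum_(i < 5) c4 i * M i.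
  by rewrite -I4; apply: eq_Rintegral => w _; rewrite E4.
have {E2}I2 : \int[P]_w ((a + X w) ^+ 2) = \sum_(i < 3) c2 i * M i.
  by rewrite -I2; apply: eq_Rintegral => w _; rewrite E2.
have := @norm_RV_even 3 (fun w => a + eta * X w) isT i4; rewrite I4.
have := @norm_RV_even 1 (fun w => a + X w) isT i2; rewrite I2.
have [_ _ /(_ a)] := hX.
(* Both norms have finite powers, which rules out infinite values. *)
have := Lnorm_ge0 P 4%:E (EFin \o (fun w => a + eta * X w)).
rewrite -/(norm_RV P 4 _).
case: (norm_RV P 4 _) => [n4| |]//.
case: (norm_RV P 2 _) => [n2| |]//.
rewrite !lee_fin -!EFin_expe => n40 n42 [e2] [e4].
have -> : a ^+ 4 + 4 * a ^+ 3 * eta * M 1%N + 6 * a ^+ 2 * eta ^+ 2 * M 2%N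
    + 4 * a * eta ^+ 3 * M 3%N + eta ^+ 4 * M 4%N = n4 ^+ 4.
  rewrite e4 !big_ord_recr big_ord0 /= M0 /c4/=; ring.
have -> : a ^+ 2 + 2 * a * M 1%N + M 2%N = n2 ^+ 2.
  rewrite e2 !big_ord_recr big_ord0 /= M0 /c2/=; ring.
rewrite -exprM lerXn2r// nnegrE.
exact: le_trans n42.
Qed.

(** The terms [a ^+ 4] cancel, so the coefficient [4 * (eta - 1) * M 1] of [a ^+ 3] must vanish, and
    [eta < 1]. *)
Let mean0 : M 1%N = 0.
Proof.
have [eta0 eta1] := andP eta01.
have /cubic_le0_lead/eqP : forall a, (4 * (eta - 1) * M 1%N) * a ^+ 3
    + (6 * eta ^+ 2 * M 2%N - 2 * M 2%N - 4 * M 1%N ^+ 2) * a ^+ 2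
    + (4 * eta ^+ 3 * M 3%N - 4 * M 1%N * M 2%N) * a
    + (eta ^+ 4 * M 4%N - M 2%N ^+ 2) <= 0.
  by move=> a; have := shifted_moments a; lra.
rewrite !mulf_eq0 pnatr_eq0/= => /orP[|/eqP//].
by rewrite subr_eq0 lt_eqF.
Qed.

(** Positivity of the variance comes from that of the 4-norm, through
    [eta ^+ 4 * M 4 <= M 2 ^+ 2]. *)
Lemma hypercontractive_moments : exists2 v, 0 < v &
  [/\ hc_moments P eta X v, (norm_RV P 2 X ^+ 2 = v%:E)%E &
      (norm_RV P 4 X ^+ 4 <= (v ^+ 2 / eta ^+ 4)%:E)%E].
Proof.
have [eta0 eta1] := andP eta01.
have n2 := @norm_RV_even 1 X isT (hypercontractive_integrable (isT : (2 <= 4)%N)).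
have n4 := @norm_RV_even 3 X isT (hypercontractive_integrable (isT : (4 <= 4)%N)).
have hm : hc_moments P eta X (M 2%N).
  split => //; first exact: hypercontractive_integrable.
  - move=> a; have := shifted_moments a; rewrite mean0 /M; lra.
have hM4 := hc_moments_fourth hm.
have M40 : 0 < M 4%N.
  have [+ _ _] := hX; move: n4; have := Lnorm_ge0 P 4%:E (EFin \o X).
  rewrite -/(norm_RV P 4 _); case: (norm_RV P 4 X) => // r _.
  by rewrite -EFin_expe lte_fin /M => -[<-] r0; rewrite exprn_gt0.
exists (M 2%N); last first.
  split => //.
  by rewrite [X in (X <= _)%E]n4 lee_fin ler_pdivlMr ?exprn_gt0// mulrC.
rewrite lt0r; apply/andP; split.
  apply/eqP => M20; move: hM4; rewrite M20 expr0n/= leNgt.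
  by rewrite mulr_gt0// exprn_gt0.
by apply: Rintegral_ge0 => w _; exact: sqr_ge0.
Qed.

End norms.

(** * Sum of the head *)

Section head_sum.
Context (d : measure_display) (T : measurableType d) (R : realType).
Variables (P : probability T R) (x : nat -> {RV P >-> R}).
Variables (b r : nat) (eta s theta : R) (v t : nat -> R).
Let L := (b * r)%N.
Hypotheses (eta01 : 0 < eta < 1) (s0 : 0 < s) (ind : independent_upto x L).
Hypothesis hv : forall j, 0 < v j /\ hc_moments P eta (x j) (v j).
Hypotheses (tS : forall j, (j < L)%N -> t j = v j + t j.+1) (tL : 0 < t L).
Hypothesis decay : forall k, (k < b)%N ->
  (1 + 16 * s ^+ 2) * t (k.+1 * r)%N <= t (k * r)%N.

Let sum_v a c : (a <= c)%N -> (c <= L)%N -> \sum_(a <= j < c) v j = t a - t c.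
Proof.
elim: c => [|c IH]; first by rewrite leqn0 => /eqP -> _; rewrite big_geq// subrr.
rewrite leq_eqVlt => /predU1P[-> _|ac cL]; first by rewrite big_geq// subrr.
by rewrite big_nat_recr//= (IH ac (ltnW cL)) (tS cL); ring.
Qed.

Let t_noninc a c : (a <= c)%N -> (c <= L)%N -> t c <= t a.
Proof.
move=> ac cL; rewrite -subr_ge0 -sum_v// sumr_ge0// => j _.
by have [/ltW] := hv j.
Qed.

Let t_gt0 a : (a <= L)%N -> 0 < t a.
Proof. by move=> aL; exact: lt_le_trans (t_noninc aL (leqnn L)). Qed.

Let eta3 : 3 * eta ^+ 4 <= 1.
Proof.
have [v0 h0] := hv 0; have := hc_moments_eta v0 h0 => e2.
have := sqr_ge0 eta; have -> : eta ^+ 4 = eta ^+ 2 * eta ^+ 2 by ring.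
nra.
Qed.

Let block_moments a c : (a <= c)%N -> (c <= L)%N ->
  hc_moments P eta (block_sum x a c) (t a - t c).
Proof.
move=> ac cL; rewrite -sum_v//.
by apply: (hc_moments_block_sum _ eta3 ind) => // j _; have [/ltW] := hv j.
Qed.

Lemma head_sum_anticoncentration :
  (P [set w | (`|block_sum x 0 L w - theta| <= s * Num.sqrt (t L))%R]
   <= ((1 - 9 / 16 * eta ^+ 4) ^+ b + b%:R / (eta ^+ 4 * s ^+ 4))%:E)%E.
Proof.
have [eta0 eta1] := andP eta01.
have kL k : (k < b)%N -> (k.+1 * r <= L)%N by move=> kb; rewrite leq_mul2r kb orbT.
(* [u k] is [s] standard deviations of everything after block [k]. Prefixes get a window of
   [2 * u k]: one [u k] for the remainder in the head, one for the final distance to [theta]. *)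
pose u k := s * Num.sqrt (t (k.+1 * r)%N).
have u0 k : (k < b)%N -> 0 < u k by move=> kb; rewrite mulr_gt0// sqrtr_gt0 t_gt0// kL.
have u2 k : (k < b)%N -> u k ^+ 2 = s ^+ 2 * t (k.+1 * r)%N.
  by move=> kb; rewrite exprMn sqr_sqrtr// ltW// t_gt0// kL.
pose near := [set w | forall k, (k < b)%N ->
  `|block_sum x 0 (k.+1 * r) w - theta| <= 2 * u k].
pose far k := [set w | u k < `|block_sum x (k.+1 * r) L w|].
have meas_abs a c y : measurable_fun setT (fun w => `|block_sum x a c w - y|).
  by apply: measurableT_comp => //; apply: measurable_funB => //; exact: measurable_block_sumT.
have meas_le a c y z : measurable [set w | `|block_sum x a c w - y| <= z].
  rewrite (_ : [set w | _] = (fun w => `|block_sum x a c w - y|) @^-1` `]-oo, z]).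
    exact: measurable_preimageT.
  by apply/seteqP; split => w /=; rewrite in_itv.
have mnear : measurable near.
  rewrite (_ : near = \bigcap_(k in [set k | (k < b)%N])
    [set w | `|block_sum x 0 (k.+1 * r) w - theta| <= 2 * u k])//.
  by apply: bigcap_measurableType => k _.
have mfar k : measurable (far k).
  rewrite (_ : far k = ~` [set w | `|block_sum x (k.+1 * r) L w - 0| <= u k]).
    exact: measurableC.
  by apply/seteqP; split => w; rewrite /far /= subr0 ltNge => /negP.
have Pnear : (P near <= ((1 - 9 / 16 * eta ^+ 4) ^+ b)%:E)%E.
  apply: (prefix_anticoncentration ind) => //.
    by have := eta3; have := exprn_even_ge0 (n := 4) eta isT; lra.
  move=> k y kb.
  have kk : (k * r <= k.+1 * r)%N by rewrite leq_mul2r leqnSn orbT.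
  have tk : 0 < t (k.+1 * r)%N by rewrite t_gt0// kL.
  have dk := decay kb.
  have s2t : 0 < s ^+ 2 * t (k.+1 * r)%N by rewrite mulr_gt0// exprn_gt0.
  apply: (hc_moments_anticoncentration _ eta01 _ _ (block_moments kk (kL k kb))).
    lra.
  (* With [c = 2 * u k], [4 * c ^+ 2] is [16 * s ^+ 2] times the next tail, which [decay] bounds by
     the variance of the block. *)
  rewrite exprMn u2//; lra.
have Pfar k : (k < b)%N -> (P (far k) <= (1 / (eta ^+ 4 * s ^+ 4))%:E)%E.
  move=> kb; have tk : 0 < t (k.+1 * r)%N by rewrite t_gt0// kL.
  apply: le_trans (hc_moments_tail eta0 (u0 k kb) (block_moments (kL k kb) (leqnn L))) _.
  rewrite lee_fin.
  have -> : u k ^+ 4 = s ^+ 4 * t (k.+1 * r)%N ^+ 2.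
    by rewrite -[4%N]/(2 * 2)%N exprM (u2 k kb); ring.
  rewrite ler_pdivrMr; last by rewrite !mulr_gt0// exprn_gt0.
  have -> : 1 / (eta ^+ 4 * s ^+ 4) * (eta ^+ 4 * (s ^+ 4 * t (k.+1 * r)%N ^+ 2)) =
      t (k.+1 * r)%N ^+ 2 by field; rewrite !gt_eqF.
  have := t_noninc (kL k kb) (leqnn L); move=> tt.
  by rewrite lerXn2r ?nnegrE ?subr_ge0// ?lerBlDr ?lerDl ltW.
apply: (@le_trans _ _ (P (near `|` \big[setU/set0]_(k < b) far k))).
  apply: le_measure; rewrite ?inE//.
    by apply: measurableU => //; exact: bigsetU_measurable.
  (* If no remainder is far, subtracting it moves the full sum by at most [u k], so every prefix is
     near [theta]. *)
  move=> w /= Aw; have [fw|nfw] := pselect (exists2 k, (k < b)%N & far k w).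
    by right; rewrite -bigcup_mkord; case: fw => k kb fk; exists k.
  left => k kb; have : ~ far k w by move=> fk; apply: nfw; exists k.
  move/negP; rewrite -leNgt => fk.
  have cat : block_sum x 0 L w = block_sum x 0 (k.+1 * r) w + block_sum x (k.+1 * r) L w.
    by rewrite /block_sum -big_cat_nat//; exact: kL.
  have -> : block_sum x 0 (k.+1 * r) w - theta =
      (block_sum x 0 L w - theta) - block_sum x (k.+1 * r) L w by rewrite cat; ring.
  apply: le_trans (ler_normB _ _) _.
  have : s * Num.sqrt (t L) <= u k.
    by rewrite ler_pM2l// ler_wsqrtr// t_noninc// kL.
  lra.
apply: le_trans (measureU2 _ _ _) _ => //; first exact: bigsetU_measurable.
rewrite EFinD leeD//.
apply: le_trans (Boole_inequality _ _) _ => //.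
apply: (@le_trans _ _ (\sum_(k < b) (1 / (eta ^+ 4 * s ^+ 4))%:E)%E).
  by apply: lee_sum => k _; exact: Pfar.
by rewrite sumEFin lee_fin sumr_const card_ord -[_ *+ _]mulr_natl mulrA mulr1.
Qed.

End head_sum.

(** * Numerical bounds on the parameters *)

Section parameters.
Context (R : realType).

Lemma absz_ceil_bounds (y : R) : 0 <= y ->
  y <= `|Num.ceil y|%N%:R /\ `|Num.ceil y|%N%:R <= y + 1.
Proof.
move=> y0; have c0 : 0 <= Num.ceil y by rewrite ceil_ge0// (lt_le_trans _ y0)// ltrN10.
have -> : `|Num.ceil y|%N%:R = (Num.ceil y)%:~R :> R.
  by rewrite -[in RHS](gez0_abs c0).
split; first exact: ceil_ge.
by have := ceilB1_lt y; rewrite intrB => /ltW; lra.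
Qed.

(** From [1 - u <= expR (- u)]. *)
Lemma onem_exp_le (u y : R) (n : nat) : 0 <= u <= 1 -> 0 < y ->
  - ln y <= u * n%:R -> (1 - u) ^+ n <= y.
Proof.
move=> /andP[u0 u1] y0 h.
apply: (@le_trans _ _ (expR (- u) ^+ n)).
  rewrite lerXn2r ?nnegrE ?subr_ge0 ?expR_ge0//.
  exact: expR_ge1Dx.
rewrite -expRM_natl -[leRHS](@lnK R)// ler_expR; lra.
Qed.

Lemma ln_ge_onem_inv (y : R) : 0 < y -> 1 - y^-1 <= ln y.
Proof.
move=> y0; have yi : 0 < y^-1 by rewrite invr_gt0.
have : ln (1 + (y^-1 - 1)) <= y^-1 - 1 by rewrite le_ln1Dx//; lra.
by rewrite (_ : 1 + (y^-1 - 1) = y^-1) ?lnV//; [lra|ring].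
Qed.

(** This and the next bound absorb the [+ 1] of the ceilings into a multiple of the logarithm. *)
Lemma ln_inv_eps (eps : R) : 0 < eps < 1 / 2 -> 1 / 2 <= ln (1 / eps).
Proof.
move=> /andP[e0 e1]; have e : 0 < 1 / eps by rewrite divr_gt0.
have := ln_ge_onem_inv e; rewrite div1r invrK; lra.
Qed.

Lemma ln_1D16_ge (s : R) : 1 < s -> 1 / 2 <= ln (1 + 16 * s ^+ 2).
Proof.
move=> s1; have s2 : 1 <= s ^+ 2 by rewrite exprn_ege1// ltW.
have h : 0 < 1 + 16 * s ^+ 2 by lra.
apply: le_trans (ln_ge_onem_inv h).
have : (1 + 16 * s ^+ 2)^-1 <= 2^-1 by rewrite lef_pV2 ?posrE//; lra.
lra.
Qed.

Lemma num_blocks_bounds (eta eps : R) : 0 < eta < 1 -> 0 < eps < 1 / 2 ->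
  2 * ln (1 / eps) <= eta ^+ 4 * (num_blocks eta eps)%:R /\
  eta ^+ 4 * (num_blocks eta eps)%:R <= 4 * ln (1 / eps).
Proof.
move=> /andP[eta0 eta1] /ln_inv_eps l.
have e4 : 0 < eta ^+ 4 by rewrite exprn_gt0.
have e41 : eta ^+ 4 <= 1 by rewrite exprn_ile1// ltW.
have y0 : 0 <= 2 / eta ^+ 4 * ln (1 / eps).
  by rewrite mulr_ge0 ?divr_ge0// ?ltW//; lra.
have [] := absz_ceil_bounds y0; rewrite -/(num_blocks eta eps).
set B := (num_blocks _ _)%:R; set l' := ln _ => h1 h2.
have E : eta ^+ 4 * (2 / eta ^+ 4 * l') = 2 * l' by field; rewrite gt_eqF.
split; first by rewrite -E ler_pM2l.
have : eta ^+ 4 * B <= eta ^+ 4 * (2 / eta ^+ 4 * l' + 1) by rewrite ler_pM2l.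
rewrite mulrDr E; rewrite -/l' in l; lra.
Qed.

Lemma block_length_bounds (eta delta s : R) : 0 < eta < 1 -> 0 < delta < 1 -> 1 < s ->
  ln (1 + 16 * s ^+ 2) <= eta ^+ 4 * delta * (block_length eta delta s)%:R /\
  eta ^+ 4 * delta * (block_length eta delta s)%:R <= 3 * ln (1 + 16 * s ^+ 2).
Proof.
move=> /andP[eta0 eta1] /andP[d0 d1] /ln_1D16_ge l.
have e4 : 0 < eta ^+ 4 * delta by rewrite mulr_gt0// exprn_gt0.
have e41 : eta ^+ 4 * delta <= 1 by apply: mulr_ile1; [exact/exprn_ge0/ltW|exact: ltW|apply: exprn_ile1; exact: ltW|exact: ltW].
have y0 : 0 <= 1 / (eta ^+ 4 * delta) * ln (1 + 16 * s ^+ 2).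
  by rewrite mulr_ge0 ?divr_ge0// ?ltW//; lra.
have [] := absz_ceil_bounds y0; rewrite -/(block_length eta delta s).
set B := (block_length _ _ _)%:R; set l' := ln _ => h1 h2.
have E : eta ^+ 4 * delta * (1 / (eta ^+ 4 * delta) * l') = l'.
  by field; rewrite !gt_eqF.
split; first by rewrite -[leLHS]E ler_pM2l.
have : eta ^+ 4 * delta * B <= eta ^+ 4 * delta * (1 / (eta ^+ 4 * delta) * l' + 1).
  by rewrite ler_pM2l.
rewrite mulrDr E; rewrite -/l' in l; lra.
Qed.

(** The constant 12 is 4 from the number of blocks times 3 from their length. Replacing
    [ln (1 + 16 * s ^+ 2)] by a multiple of [ln s] needs [s] bounded away from 1, whence the
    dependence on [s0]. *)
Lemma head_length_le (s0 eta delta eps s : R) :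
  1 < s0 -> 0 < eta < 1 -> 0 < delta < 1 -> 0 < eps < 1 / 2 -> s0 <= s ->
  (head_length eta delta eps s)%:R
    <= 12 * (ln 17 / ln s0 + 2) * (ln s * ln (1 / eps) / eta ^+ 8) * (1 / delta).
Proof.
move=> s01 eta01 delta01 eps01 s0s.
have s1 : 1 < s by exact: lt_le_trans s0s.
have [_ hb] := num_blocks_bounds eta01 eps01.
have [_ hr] := block_length_bounds eta01 delta01 s1.
have l := ln_inv_eps eps01.
have [eta0 _] := andP eta01; have [d0 _] := andP delta01.
have ls0 : 0 < ln s0 by rewrite ln_gt0.
have lss : ln s0 <= ln s by rewrite ler_ln ?posrE//; lra.
have l17 : 0 <= ln 17 :> R by rewrite ln_ge0//; lra.
have hs : ln (1 + 16 * s ^+ 2) <= (ln 17 / ln s0 + 2) * ln s.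
  apply: (@le_trans _ _ (ln 17 + 2 * ln s)).
    have -> : 2 * ln s = ln (s ^+ 2) by rewrite lnXn ?mulr_natl//; lra.
    rewrite -lnM ?posrE ?exprn_gt0//; [|lra..].
    have s2 : 1 <= s ^+ 2 by rewrite exprn_ege1// ltW.
    by rewrite ler_ln ?posrE; lra.
  have : ln 17 * 1 <= ln 17 * (ln s / ln s0).
    by rewrite ler_wpM2l// ler_pdivlMr// mul1r.
  have -> : (ln 17 / ln s0 + 2) * ln s = ln 17 * (ln s / ln s0) + 2 * ln s by ring.
  lra.
rewrite /head_length natrM.
set B := (num_blocks _ _)%:R in hb *; set r := (block_length _ _ _)%:R in hr *.
have e8 : 0 < eta ^+ 8 * delta by rewrite mulr_gt0// exprn_gt0.
rewrite -(ler_pM2l e8).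
set l' := ln (1 / eps) in l hb *; set S := ln (1 + _) in hs hr *.
set K := ln 17 / _ + _ in hs *.
have -> : eta ^+ 8 * delta * (12 * K * (ln s * l' / eta ^+ 8) * (1 / delta)) =
    (4 * l') * (3 * (K * ln s)) by field; rewrite !gt_eqF.
have -> : eta ^+ 8 * delta * (B * r) = (eta ^+ 4 * B) * (eta ^+ 4 * delta * r) by ring.
apply: ler_pM => //.
- by rewrite mulr_ge0// exprn_ge0// ltW.
- by rewrite !mulr_ge0// ?exprn_ge0// ltW.
- by apply: le_trans hr _; rewrite ler_pM2l.
Qed.

End parameters.

(** * Critical index, and indexing by natural numbers *)

Section sequences.
Context (d : measure_display) (T : measurableType d) (R : realType).
Variables (P : probability T R) (n : nat) (X : 'I_n.+1 -> {RV P >-> R}).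

Lemma critical_index_ge_not_regular (delta : R) (L i : nat) :
  (i <= n)%N -> (i < L)%N -> critical_index_ge X delta L ->
  ~ regular X delta (tail_from i).
Proof.
move=> i_n iL; rewrite /critical_index_ge /critical_index.
case: pickP => [l /asboolP[_ lmin] Ll ri|none _ ri].
  have := lmin (Ordinal (i_n : (i < n.+1)%N)) ri => /= li.
  by have := leq_trans Ll li; rewrite leqNgt iL.
(* When the index is infinite, a regular tail would give a least regular one, which the pick would
   have found. *)
pose p (k : 'I_n.+1) := `[< regular X delta (tail_from k) >].
have pi : p (Ordinal (i_n : (i < n.+1)%N)) by apply/asboolP.
case: (arg_minnP (fun k : 'I_n.+1 => val k) pi) => k /asboolP rk kmin.
have /negP := negbT (none k); apply; apply/asboolP; split => // j rj.
by apply: kmin; apply/asboolP.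
Qed.

Lemma independent_upto_inord (L : nat) : (L <= n)%N ->
  independent_RVs X (fun j : 'I_n.+1 => (j < L)%N) ->
  independent_upto (fun j => X (inord j)) L.
Proof.
move=> Ln ind A mA.
pose K : {set 'I_n.+1} := [set j : 'I_n.+1 | (j < L)%N]%SET.
have := ind K (fun j => A j); rewrite -/K.
have -> : \bigcap_(j in [set` K]) (X j @^-1` A j) =
    [set w | forall j, (j < L)%N -> A j (X (inord j) w)].
  apply/seteqP; split => w /= Aw j.
    move=> jL; have jn : (j < n.+1)%N by rewrite ltnS (leq_trans (ltnW jL)).
    by have := Aw (inord j); rewrite /= inE inordK//; exact.
  by rewrite /= inE => /Aw; rewrite inord_val.
move=> ->; last 2 first.
- by move=> j; rewrite inE.
- by [].
transitivity (\big[*%E/1%E]_(0 <= j < n.+1 | (j < L)%N) P (X (inord j) @^-1` A j))%E.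
  rewrite big_mkord; apply: eq_big => [j|j _]; first by rewrite inE.
  by rewrite inord_val.
rewrite (@big_cat_nat _ _ _ L)//=; last exact: leq_trans Ln _.
rewrite [X in (_ * X)%E]big_nat_cond [X in (_ * X)%E]big1 ?mule1; last first.
  by move=> j /andP[/andP[Lj _] jL]; move: Lj; rewrite leqNgt jL.
rewrite -(big_mkord xpredT (fun j => P (X (inord j) @^-1` A j))).
rewrite big_nat_cond [RHS]big_nat_cond; apply: eq_bigl => j.
by rewrite andbT /= andbb.
Qed.

End sequences.

Theorem theorem5p1 (R : realType) :
  (exists C : R, 0 < C /\
    forall (d : measure_display) (T : measurableType d) (P : probability T R)
      (n : nat) (X : 'I_n.+1 -> {RV P >-> R}) (eta delta eps s : R),
    let L := head_length eta delta eps s in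
    0 < eta < 1 ->
    pairwise_independent_RVs X ->
    (forall j, hypercontractive P eta (X j)) ->
    0 < delta < 1 -> 0 < eps < 1 / 2 -> 1 < s ->
    (forall i j : 'I_n.+1, (i <= j)%N -> (sigma_sq X j <= sigma_sq X i)%E) ->
    (L <= n)%N ->
    independent_RVs X (fun j : 'I_n.+1 => (j < L)%N) ->
    critical_index_ge X delta L ->
    forall theta : R,
      (P [set w | (`|\sum_(j < n.+1 | (j < L)%N) X j w - theta|%:E
                     <= s%:E * tau X L)%E]
       <= (eps + C * ln (1 / eps) / (eta ^+ 8 * s ^+ 4))%:E)%E)
  /\
  (forall s0 : R, 1 < s0 -> exists C : R, 0 < C /\
    forall eta delta eps s : R,
    0 < eta < 1 -> 0 < delta < 1 -> 0 < eps < 1 / 2 -> s0 <= s ->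
    (head_length eta delta eps s)%:R
      <= C * (ln s * ln (1 / eps) / eta ^+ 8) * (1 / delta)).
Proof.
split; last first.
  move=> s0 s01; exists (12 * (ln 17 / ln s0 + 2)).
  split=> [|eta delta eps s]; last exact: head_length_le.
  have ls0 : 0 < ln s0 by rewrite ln_gt0.
  have : 0 <= ln 17 / ln s0 by rewrite divr_ge0 ?(ltW ls0)// ln_ge0//; lra.
  lra.
(* The constant 4 is the one in [eta ^+ 4 * b <= 4 * ln (1 / eps)]. *)
exists 4; split=> // d T P n X eta delta eps s L eta01 _ hX delta01 eps01 s1 mono Ln ind crit theta.
have [eta0 eta1] := andP eta01; have [delta0 delta1] := andP delta01.
have [eps0 _] := andP eps01; have s0 : 0 < s by lra.
have eta4 : 0 < eta ^+ 4 by rewrite exprn_gt0.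
have eta41 : eta ^+ 4 <= 1 by apply: exprn_ile1; exact: ltW.
(* Beyond [n], [inord] returns an index in range, so [x j] is hypercontractive for every [j]; the
   tails [t] sum only up to [n]. *)
pose x j := X (inord j).
pose v j := fine (norm_RV P 2 (x j) ^+ 2)%E.
have hv j : [/\ 0 < v j, hc_moments P eta (x j) (v j),
    (norm_RV P 2 (x j) ^+ 2 = (v j)%:E)%E &
    (norm_RV P 4 (x j) ^+ 4 <= (v j ^+ 2 / eta ^+ 4)%:E)%E].
  have [v' v'0 [h h2 h4]] := hypercontractive_moments eta01 (hX (inord j)).
  by rewrite /v /x h2 /=; split.
have sigmaE (j : 'I_n.+1) : sigma_sq X j = (v j)%:E.
  by have [_ _ <- _] := hv j; rewrite /x inord_val.
pose t i := \sum_(i <= j < n.+1) v j.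
have tailE i (F : nat -> R) : \sum_(j < n.+1 | tail_from i j) F j = \sum_(i <= j < n.+1) F j.
  by rewrite big_geq_mkord.
have sumsigma i : (\sum_(j < n.+1 | tail_from i j) sigma_sq X j = (t i)%:E)%E.
  by rewrite /t -tailE -sumEFin; apply: eq_bigr => j _; rewrite sigmaE.
have tauE i : tau X i = (Num.sqrt (t i))%:E by rewrite /tau sumsigma.
have tS j : (j <= n)%N -> t j = v j + t j.+1 by move=> jn; rewrite /t big_ltn.
have t0 i : (i <= n)%N -> 0 < t i.
  move=> i_n; rewrite (tS i i_n) ltr_wpDr//; last by have [] := hv i.
  by rewrite sumr_ge0// => j _; have [/ltW] := hv j.
have v_noninc i j : (i <= j)%N -> (j <= n)%N -> v j <= v i.
  move=> ij jn; have jn1 : (j < n.+1)%N by [].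
  have in1 : (i < n.+1)%N by exact: leq_ltn_trans jn1.
  have := mono (Ordinal in1) (Ordinal jn1) ij.
  by rewrite !sigmaE lee_fin.
pose u := eta ^+ 4 * delta.
have u0 : 0 < u by rewrite mulr_gt0.
have u1 : u <= 1 by apply: mulr_ile1 => //; exact: ltW.
(* If [v i < u * t i], then the fourth norms sum to at most [v i * t i / eta ^+ 4], by the ordering,
   and so to at most [delta * t i ^+ 2]: the tail would be regular. *)
have ut_le_v i : (i < L)%N -> u * t i <= v i.
  move=> iL; have i_n : (i <= n)%N by exact: leq_trans (ltnW iL) Ln.
  have nr := critical_index_ge_not_regular i_n iL crit.
  rewrite leNgt; apply/negP => vlt; apply: nr.
  have := sumsigma i; rewrite /regular /sigma_sq => ->.
  apply: (@le_trans _ _ (\sum_(j < n.+1 | tail_from i j) (v j ^+ 2 / eta ^+ 4)%:E)%E).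
    by apply: lee_sum => j _; have [_ _ _] := hv j; rewrite /x inord_val.
  rewrite sumEFin -EFin_expe -EFinM lee_fin (tailE i (fun j => v j ^+ 2 / eta ^+ 4)).
  apply: (@le_trans _ _ (\sum_(i <= j < n.+1) v i / eta ^+ 4 * v j)).
    rewrite big_nat_cond [leRHS]big_nat_cond.
    apply: ler_sum => j /andP[/andP[ij jn] _]; have [vj0 _ _ _] := hv j.
    rewrite [leRHS]mulrAC ler_pM2r ?invr_gt0// expr2 ler_pM2r//.
    exact: v_noninc.
  rewrite -mulr_sumr -/(t i) expr2 mulrA ler_pM2r ?t0//.
  by rewrite ler_pdivrMr// (_ : delta * t i * eta ^+ 4 = u * t i) ?ltW// /u; ring.
have decay1 j m : (j + m <= L)%N -> t (j + m)%N <= (1 - u) ^+ m * t j.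
  elim: m => [|m IH]; first by rewrite addn0 mul1r.
  rewrite addnS => jmL; have jm_n : (j + m <= n)%N by exact: leq_trans (ltnW jmL) Ln.
  have h1 := ut_le_v _ jmL; have h2 := tS _ jm_n.
  have : (1 - u) * t (j + m)%N <= (1 - u) * ((1 - u) ^+ m * t j).
    by rewrite ler_wpM2l ?subr_ge0// IH// ltnW.
  by rewrite mulrA -exprS; lra.
set b := num_blocks eta eps; set r := block_length eta delta s.
have LE : L = (b * r)%N by [].
have s2 : 0 < s ^+ 2 by rewrite exprn_gt0.
have s16 : 0 < 1 + 16 * s ^+ 2 by lra.
have [hr _] := block_length_bounds eta01 delta01 s1.
(* The block length is chosen so that [u * r] is at least the logarithm of the required drop. *)
have ur : (1 - u) ^+ r <= (1 + 16 * s ^+ 2)^-1.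
  apply: onem_exp_le; rewrite ?invr_gt0//; first by rewrite u1 ltW.
  by rewrite lnV ?posrE// opprK.
have decay k : (k < b)%N -> (1 + 16 * s ^+ 2) * t (k.+1 * r)%N <= t (k * r)%N.
  move=> kb; have kL : (k * r + r <= L)%N.
    by rewrite addnC -mulSn LE leq_mul2r kb orbT.
  have tk : 0 < t (k * r)%N by apply: t0; exact: leq_trans (leq_trans (leq_addr _ _) kL) Ln.
  rewrite -ler_pdivlMl// mulSn addnC.
  by apply: le_trans (decay1 _ _ kL) _; rewrite ler_pM2r.
have tL : 0 < t L by exact: t0.
have hv' j : 0 < v j /\ hc_moments P eta (x j) (v j) by have [] := hv j.
have indx : independent_upto x L by exact: independent_upto_inord.
have tS' j : (j < L)%N -> t j = v j + t j.+1.
  by move=> jL; apply: tS; exact: leq_trans (ltnW jL) Ln.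
have := head_sum_anticoncentration (b := b) (r := r) theta eta01 s0 indx hv' tS' tL decay.
rewrite -LE (_ : [set w | _] =
    [set w | (`|\sum_(j < n.+1 | (j < L)%N) X j w - theta|%:E <= s%:E * tau X L)%E]); last first.
  have sumE w : \sum_(j < n.+1 | (j < L)%N) X j w = block_sum x 0 L w.
    rewrite /block_sum big_mkord (big_ord_widen n.+1 (fun j => x j w)) ?(leq_trans Ln)//.
    by apply: eq_bigr => j _; rewrite /x inord_val.
  by apply/seteqP; split => w /=; rewrite tauE -EFinM lee_fin sumE.
move=> h; apply: le_trans h _; rewrite lee_fin.
have [hb1 hb2] := num_blocks_bounds eta01 eps01.
have l := ln_inv_eps eps01.
apply: lerD.
  (* Here [9 / 16 * eta ^+ 4 * b] is at least [9 / 8 * ln (1 / eps)], which suffices. *)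
  apply: onem_exp_le => //; first by apply/andP; split; lra.
  have -> : - ln eps = ln (1 / eps) by rewrite div1r lnV ?posrE.
  rewrite -/b in hb1; lra.
have e8 : 0 < eta ^+ 8 * s ^+ 4 by rewrite mulr_gt0 ?exprn_gt0.
rewrite ler_pdivlMr//.
have -> : b%:R / (eta ^+ 4 * s ^+ 4) * (eta ^+ 8 * s ^+ 4) = eta ^+ 4 * b%:R.
  by field; rewrite !gt_eqF.
exact: hb2.
Qed.
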